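(* Let $B:\mathfrak b\to\mathfrak a$ be a left deformation map on a quasi-twilled Lie conformal algebra $(\mathcal E,\mathfrak a,\mathfrak b)$. Then the $\lambda$-product $$\{u_\lambda v\}^B_{\mathfrak b}=\{u_\lambda v\}_{\mathfrak b}+\varrho_{\mathfrak a}(B(u))_\lambda v-\varrho_{\mathfrak a}(B(v))_{-\lambda-\partial}u+\psi_{1,\lambda}(B(u),B(v)),\qquad u,v\in\mathfrak b,$$ is a Lie conformal algebra structure on $\mathfrak b$.
   Context: All vector spaces and linear maps are over $\mathbb C$, and all $\mathbb C[\partial]$-modules are finitely generated. A Lie conformal algebra is a $\mathbb C[\partial]$-module $\mathcal E$ with a $\mathbb C$-linear map $\mathcal E\otimes\mathcal E\to\mathcal E[\lambda]$, $x\otimes y\mapsto\{x_\lambda y\}$, such that $\{\partial x_\lambda y\}=-\lambda\{x_\lambda y\}$, $\{x_\lambda\partial y\}=(\partial+\lambda)\{x_\lambda y\}$, $\{x_\lambda y\}=-\{y_{-\lambda-\partial}x\}$ and $\{x_\lambda\{y_\mu z\}\}=\{\{x_\lambda y\}_{\lambda+\mu}z\}+\{y_\mu\{x_\lambda z\}\}$. The subscript $-\lambda-\partial$ means that the formal variable is replaced by $-\lambda-\partial$, with $\partial$ acting from the left on the coefficients. $\mathbb C[\partial]$-module maps are extended to polynomials coefficientwise. A quasi-twilled Lie conformal algebra $(\mathcal E,\mathfrak a,\mathfrak b)$ is a Lie conformal algebra $\mathcal E$ with a decomposition $\mathcal E=\mathfrak a\oplus\mathfrak b$ of $\mathbb C[\partial]$-modules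 such that $\mathfrak b$ is a Lie conformal subalgebra. With $\mathrm{pr}_{\mathfrak a},\mathrm{pr}_{\mathfrak b}$ the projections, for $a,b\in\mathfrak a$, $u,v\in\mathfrak b$ set $\{a_\lambda b\}_{\mathfrak a}=\mathrm{pr}_{\mathfrak a}\{a_\lambda b\}$, $\psi_{1,\lambda}(a,b)=\mathrm{pr}_{\mathfrak b}\{a_\lambda b\}$, $\varrho_{\mathfrak b}(u)_\lambda a=\mathrm{pr}_{\mathfrak a}\{u_\lambda a\}$, $\varrho_{\mathfrak a}(a)_\lambda v=\mathrm{pr}_{\mathfrak b}\{a_\lambda v\}$, $\{u_\lambda v\}_{\mathfrak b}=\mathrm{pr}_{\mathfrak b}\{u_\lambda v\}=\{u_\lambda v\}$. A left deformation map of $(\mathcal E,\mathfrak a,\mathfrak b)$ is a $\mathbb C[\partial]$-module homomorphism $B:\mathfrak b\to\mathfrak a$ whose graph $\mathrm{Gr}(B)=\{(B(u),u)\mid u\in\mathfrak b\}\subset\mathcal E$ is a Lie conformal subalgebra of $\mathcal E$. *)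

(* Defs.v *)
From HB Require Import structures.
From mathcomp Require Import all_boot all_algebra.
From mathcomp Require Import finmap monalg complex reals.

Set Implicit Arguments.
Unset Strict Implicit.
Unset Printing Implicit Defensive.

Import GRing.Theory.
Local Open Scope ring_scope.

(* The module M[t] of polynomials in t with coefficients in an R-module M, as
   finitely supported families of coefficients; p@_k is the coefficient of t^k.
   It is a module over R[t], with scalar product the Cauchy product. *)
Definition polymod (R : nzRingType) (M : lmodType R) : Type := {malg M[nat]}.

HB.instance Definition _ (R : nzRingType) (M : lmodType R) :=
  GRing.Zmodule.on (polymod M).

Section PolymodScale.
Context {R : nzRingType} {M : lmodType R}.
Implicit Types (p q : {poly R}) (f g : polymod M).

Definition polymod_scale p f : polymod M :=
  \sum_(i < size p) \sum_(k <- msupp f) << p`_i *: f@_k *g (i + k)%N >>.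

Lemma coef_polymod_scale p f n :
  (polymod_scale p f)@_n = \sum_(i < n.+1) p`_i *: f@_(n - i)%N.
Proof.
have inner i : (\sum_(k <- msupp f) << p`_i *: f@_k *g (i + k)%N >>)@_n
    = if (i <= n)%N then p`_i *: f@_(n - i)%N else 0.
  rewrite raddf_sum /=; case: ifP => [le_in|nle_in]; last first.
    rewrite big1 // => k _; rewrite mcoeffU; case: eqP => // e.
    by rewrite -e leq_addr in nle_in.
  have E k : (<< p`_i *: f@_k *g (i + k)%N >> : {malg M[nat]})@_n
      = if k == (n - i)%N then p`_i *: f@_(n - i)%N else 0.
    rewrite mcoeffU -[in (_ == n)](subnKC le_in) eqn_add2l.
    by case: eqP => // ->.
  under eq_bigr do rewrite E.
  rewrite -big_mkcond /=; case: (boolP ((n - i)%N \in msupp f)) => sf.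
    rewrite -big_filter (_ : filter _ _ = [:: (n - i)%N]) ?big_seq1 //.
    by rewrite (@filter_pred1_uniq _ (msupp f)) // fset_uniq.
  rewrite (mcoeff_outdom sf) scaler0.
  by rewrite big1.
rewrite /polymod_scale raddf_sum /=.
under eq_bigr do rewrite inner.
rewrite -(big_mkord xpredT (fun i => if (i <= n)%N then p`_i *: f@_(n - i)%N else 0)).
rewrite -(big_mkord xpredT (fun i => p`_i *: f@_(n - i)%N)).
set N := maxn (size p) n.+1.
rewrite (big_nat_widen _ _ N) ?leq_maxl // [RHS](big_nat_widen _ _ N) ?leq_maxr //.
rewrite big_mkcond [RHS]big_mkcond; apply: eq_bigr => i _ /=.
rewrite ltnS; case: ltnP => // le_pi; case: ifP => // _.
by rewrite nth_default ?scale0r.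
Qed.

Fact polymod_scaleA p q f :
  polymod_scale p (polymod_scale q f) = polymod_scale (p * q) f.
Proof.
apply/malgP => n; rewrite !coef_polymod_scale.
pose F (i m : nat) := if (i <= m)%N then (p`_i * q`_(m - i)%N) *: f@_(n - m)%N else 0.
transitivity (\sum_(i < n.+1) \sum_(0 <= m < n.+1) F i m).
  apply: eq_bigr => i _; rewrite coef_polymod_scale scaler_sumr.
  have le_in : (i <= n)%N by rewrite -ltnS.
  rewrite (@big_cat_nat _ _ _ i) //=; last exact: leqW.
  rewrite [X in _ = X + _]big_nat_cond [X in _ = X + _]big1 ?add0r; last first.
    by move=> m /andP[/andP[_ lt_mi] _]; rewrite /F leqNgt lt_mi.
  have shift (G : nat -> M) :
      \sum_(i <= m < n.+1) G m = \sum_(j < (n - i).+1) G (j + i)%N.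
    by rewrite -{1}[nat_of_ord i]add0n big_addn subSn // big_mkord.
  rewrite shift.
  apply: eq_bigr => j _.
  by rewrite /F leq_addl addnK scalerA addnC subnDA.
rewrite exchange_big /= big_mkord; apply: eq_bigr => m _.
rewrite coefM scaler_suml.
rewrite -(big_mkord xpredT (fun i => F i m)).
rewrite -(big_mkord xpredT (fun i => (p`_i * q`_(m - i)%N) *: f@_(n - m)%N)).
rewrite [RHS](big_nat_widen _ _ n.+1) // [RHS]big_mkcond.
by apply: eq_bigr => i _; rewrite ltnS.
Qed.

Fact polymod_scale1 : left_id 1 polymod_scale.
Proof.
move=> f; apply/malgP => n; rewrite coef_polymod_scale big_ord_recl /= subn0.
rewrite big1 ?addr0 => [|i _]; last by rewrite coef1 scale0r.
by rewrite coef1 scale1r.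
Qed.

Fact polymod_scaleDr : right_distributive polymod_scale +%R.
Proof.
move=> p f g; apply/malgP => n; rewrite mcoeffD !coef_polymod_scale -big_split.
by apply: eq_bigr => i _; rewrite mcoeffD scalerDr.
Qed.

Fact polymod_scaleDl f : {morph polymod_scale^~ f : p q / p + q}.
Proof.
move=> p q; apply/malgP => n; rewrite mcoeffD !coef_polymod_scale -big_split.
by apply: eq_bigr => i _; rewrite coefD scalerDl.
Qed.

HB.instance Definition _ := GRing.Zmodule_isLmodule.Build {poly R} (polymod M)
  polymod_scaleA polymod_scale1 polymod_scaleDr polymod_scaleDl.

Lemma coef_polymodZ p f n :
  (p *: f : polymod M)@_n = \sum_(i < n.+1) p`_i *: f@_(n - i)%N.
Proof. exact: coef_polymod_scale. Qed.

End PolymodScale.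

Definition polymodC (R : nzRingType) (M : lmodType R) (m : M) : polymod M :=
  << m *g 0%N >>.

Definition polymod_map (R : nzRingType) (M N : lmodType R) (f : M -> N)
    (p : polymod M) : polymod N :=
  \sum_(k <- msupp p) << f p@_k *g k >>.

(* Substitution t := s: sends the sum of the m_k t^k to the sum of the
   s^k f(m_k), with s acting from the left. *)
Definition polymod_subst (R S : nzRingType) (M : lmodType R) (N : lmodType S)
    (f : M -> N) (s : S) (p : polymod M) : N :=
  \sum_(k <- msupp p) s ^+ k *: f p@_k.

Section LieConformal.
Context {R : realType}.
Local Notation C := R[i].
(* A C[del]-module is an lmodType over {poly C}, del being 'X. Then E[lambda]
   is a module over C[del][lambda], and E[lambda][mu] over
   C[del][lambda][mu]. *)
Local Notation Cdel := {poly C}.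
Local Notation del := ('X : {poly C}).

Definition fin_gen (E : lmodType Cdel) : Prop :=
  exists (n : nat) (g : 'I_n -> E), forall x : E,
    exists c : 'I_n -> Cdel, x = \sum_(i < n) c i *: g i.

(* p(-lambda-del), again an element of E[lambda]. *)
Definition at_opp_lambda_del (E : lmodType Cdel) (p : polymod E) : polymod E :=
  polymod_subst (@polymodC _ E) (- 'X - del%:P) p.

Section Bracket.
Context {E : lmodType Cdel} (br : E -> E -> polymod E).

Local Notation lambda := (('X : {poly Cdel})%:P : {poly {poly Cdel}}).
Local Notation mu := ('X : {poly {poly Cdel}}).

(* {x_s y} in E[lambda][mu], for a polynomial s in lambda, mu, del. *)
Definition br_at (s : {poly {poly Cdel}}) (x y : E) : polymod (polymod E) :=
  polymod_subst (fun m => polymodC (polymodC m)) s (br x y).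

Record lie_conformal : Prop := LieConformal {
  lc_fin_gen : fin_gen E;
  lc_linear_l : forall (c : C) (x x' y : E),
    br (c%:P *: x + x') y = c%:P%:P *: br x y + br x' y;
  lc_linear_r : forall (c : C) (x y y' : E),
    br x (c%:P *: y + y') = c%:P%:P *: br x y + br x y';
  lc_del_l : forall x y : E, br (del *: x) y = - ('X *: br x y);
  lc_del_r : forall x y : E, br x (del *: y) = (del%:P + 'X) *: br x y;
  lc_skew : forall x y : E, br x y = - at_opp_lambda_del (br y x);
  lc_jacobi : forall x y z : E,
    polymod_subst (fun w => br_at lambda x w) mu (br y z)
    = polymod_subst (fun w => br_at (lambda + mu) w z) lambda (br x y)
      + polymod_subst (fun w => br_at mu y w) lambda (br x z)
}.

Record lie_conformal_sub (S : E -> Prop) : Prop := LieConformalSub {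
  lcs_0 : S 0;
  lcs_linear : forall (p : Cdel) (x y : E), S x -> S y -> S (p *: x + y);
  lcs_br : forall (x y : E) (k : nat), S x -> S y -> S (br x y)@_k
}.

End Bracket.

(* a and b are C[del]-submodules of E, with inclusions val; qt_decomp,
   qt_pra_val_b and qt_prb_val_a say that E is their direct sum, with
   projections qt_pra and qt_prb. *)
Record quasi_twilled (E : lmodType Cdel) (br : E -> E -> polymod E)
    (Sa Sb : pred E) (a : subLmodType Sa) (b : subLmodType Sb) := QuasiTwilled {
  qt_lie_conformal : lie_conformal br;
  qt_pra : {linear E -> a};
  qt_prb : {linear E -> b};
  qt_decomp : forall x : E, x = val (qt_pra x) + val (qt_prb x);
  qt_pra_val_b : forall u : b, qt_pra (val u) = 0;
  qt_prb_val_a : forall x : a, qt_prb (val x) = 0;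
  qt_sub : lie_conformal_sub br (fun x => Sb x)
}.

Section QuasiTwilled.
Context {E : lmodType Cdel} {br : E -> E -> polymod E} {Sa Sb : pred E}.
Context {a : subLmodType Sa} {b : subLmodType Sb}.
Context (Q : quasi_twilled br a b).

Definition left_deformation_map (_ : quasi_twilled br a b)
    (B : {linear b -> a}) : Prop :=
  lie_conformal_sub br (fun x => exists u : b, x = val (B u) + val u).

Definition qt_psi1 (x y : a) : polymod b :=
  polymod_map (qt_prb Q) (br (val x) (val y)).

Definition qt_rho_a (x : a) (v : b) : polymod b :=
  polymod_map (qt_prb Q) (br (val x) (val v)).

Definition qt_br_b (u v : b) : polymod b :=
  polymod_map (qt_prb Q) (br (val u) (val v)).

Definition deformed_br (B : {linear b -> a}) (u v : b) : polymod b :=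
  qt_br_b u v + qt_rho_a (B u) v - at_opp_lambda_del (qt_rho_a (B v) u)
  + qt_psi1 (B u) (B v).

End QuasiTwilled.

End LieConformal.

(* Main.v *)
Require Import Defs.
From HB Require Import structures.
From mathcomp Require Import all_boot all_algebra.
From mathcomp Require Import finmap monalg complex reals.

Local Open Scope ring_scope.

(** Write [G u = B u + u] ([graph]) for the embedding of [b] in [E] whose image is the
    graph of [B]; the projection [P = qt_prb Q] of [E] onto [b] is a retraction of it.
    By bilinearity and skew-symmetry in [E], the deformed product of [u] and
    [v] is exactly [P] applied to the coefficients of [{G u _lambda G v}]: its
    four terms come from expanding [G u] and [G v], the third one being
    [{u _lambda B v}] with its arguments exchanged ([deformed_br_graph]).
    As the graph is a subalgebra, those coefficients lie in the image of [G],
    where [G \o P] is the identity, so [G] carries the deformed product to the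
    bracket of [E] ([graph_br]).  The axioms of a Lie conformal algebra are
    identities between expressions natural in the underlying module, hence
    they descend along an injective map that preserves the products
    ([lie_conformal_inj]); finite generation holds because [P] is onto. *)

Import GRing.Theory.
Set Implicit Arguments.
Unset Strict Implicit.
Unset Printing Implicit Defensive.

(** * Naturality of coefficientwise maps and substitutions *)

Section PolymodMap.
Context {R : nzRingType} {M N : lmodType R}.

Lemma coef_polymod_map (f : M -> N) (p : polymod M) k :
  f 0 = 0 -> (polymod_map f p)@_k = f p@_k.
Proof.
move=> f0; rewrite /polymod_map raddf_sum /=.
under eq_bigr do rewrite mcoeffU.
case: (boolP (k \in msupp p)) => [kp|kNp].
  rewrite (big_fsetD1 k) //= eqxx big1_fset ?addr0 // => i.
  by rewrite in_fsetD1 => /andP[/negPf->].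
rewrite (mcoeff_outdom kNp) f0 big1_fset // => i ip _.
by case: eqP => // ik; rewrite -ik ip in kNp.
Qed.

Section Linear.
Variable f : {linear M -> N}.

Fact polymod_map_is_linear : linear (polymod_map f : polymod M -> polymod N).
Proof.
move=> c p q; apply/malgP => k.
rewrite mcoeffD coef_polymodZ !coef_polymod_map ?linear0 // mcoeffD raddfD /=.
rewrite coef_polymodZ linear_sum /=; congr (_ + _); apply: eq_bigr => i _.
by rewrite linearZ coef_polymod_map ?linear0.
Qed.

HB.instance Definition _ := GRing.isLinear.Build {poly R} (polymod M) (polymod N)
  _ (polymod_map f : polymod M -> polymod N) polymod_map_is_linear.

Lemma polymod_map_inj : injective f ->
  injective (polymod_map f : polymod M -> polymod N).
Proof.
move=> f_inj p q /malgP e; apply/malgP => k; apply: f_inj.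
by have := e k; rewrite !coef_polymod_map ?linear0.
Qed.

Lemma polymod_map_polymodC (m : M) :
  polymod_map f (polymodC m) = polymodC (f m).
Proof.
apply/malgP => k; rewrite coef_polymod_map ?linear0 //.
by rewrite !mcoeffU; case: eqP => // _; rewrite ?linear0.
Qed.

End Linear.
End PolymodMap.

Section PolymodSubst.
Context {R S : nzRingType} {M M' : lmodType R} {N N' : lmodType S}.

Lemma eq_polymod_subst (f g : M -> N) (s : S) (p : polymod M) :
  f =1 g -> polymod_subst f s p = polymod_subst g s p.
Proof. by move=> fg; apply: eq_bigr => i _; rewrite fg. Qed.

Lemma linear_polymod_subst (h : {linear N -> N'}) (f : M -> N) s p :
  h (polymod_subst f s p) = polymod_subst (fun m => h (f m)) s p.
Proof. by rewrite linear_sum; apply: eq_bigr => i _; rewrite linearZ. Qed.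

(** [g] may kill coefficients, so the two sums range over different supports;
    [f 0 = 0] makes the extra terms vanish. *)
Lemma polymod_subst_map (f : M' -> N) (g : M -> M') s (p : polymod M) :
  f 0 = 0 -> g 0 = 0 ->
  polymod_subst f s (polymod_map g p) = polymod_subst (fun m => f (g m)) s p.
Proof.
move=> f0 g0; rewrite /polymod_subst.
under eq_bigr do rewrite coef_polymod_map //.
apply: big_fset_incl => [|i ip].
  apply/fsubsetP => i; rewrite -!mcoeff_neq0 coef_polymod_map //.
  by apply: contra => /eqP->; rewrite g0.
by rewrite -mcoeff_eq0 coef_polymod_map // => /eqP->; rewrite f0 scaler0.
Qed.

End PolymodSubst.

(** * Lie conformal algebras *)

Section LieConformal.
Context {R : realType}.
Local Notation Cdel := {poly R[i]}.

Lemma polymod_map_at_opp (E F : lmodType Cdel) (h : {linear E -> F})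
    (p : polymod E) :
  polymod_map h (at_opp_lambda_del p) = at_opp_lambda_del (polymod_map h p).
Proof.
rewrite /at_opp_lambda_del linear_polymod_subst polymod_subst_map ?linear0 //.
  by apply: eq_polymod_subst => m; rewrite /= polymod_map_polymodC.
exact: monalgU0.
Qed.

Lemma fin_gen_surj (E F : lmodType Cdel) (h : {linear E -> F}) (g : F -> E) :
  cancel g h -> fin_gen E -> fin_gen F.
Proof.
move=> gK [n [e gen]]; exists n, (fun i => h (e i)) => x.
have [c cE] := gen (g x); exists c.
by rewrite -(gK x) cE linear_sum; apply: eq_bigr => i _; rewrite linearZ.
Qed.

Section Bracket.
Context {E : lmodType Cdel} {br : E -> E -> polymod E}.
Hypothesis lie : lie_conformal br.

Lemma lie_brDl x x' y : br (x + x') y = br x y + br x' y.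
Proof. by have := lc_linear_l lie 1 x x' y; rewrite !polyC1 !scale1r. Qed.

Lemma lie_brDr x y y' : br x (y + y') = br x y + br x y'.
Proof. by have := lc_linear_r lie 1 x y y'; rewrite !polyC1 !scale1r. Qed.

Lemma lie_br0l y : br 0 y = 0.
Proof. by apply: (addrI (br 0 y)); rewrite -lie_brDl !addr0. Qed.

Lemma lie_br0r x : br x 0 = 0.
Proof. by apply: (addrI (br x 0)); rewrite -lie_brDr !addr0. Qed.

(** The injectivity of [g] turns an identity in [E[lambda]] or
    [E[lambda][mu]] between images into one over [F]; each side of an axiom
    commutes with [g] because brackets and substitutions do. *)
Lemma lie_conformal_inj (F : lmodType Cdel) (brF : F -> F -> polymod F)
    (g : {linear F -> E}) :
  injective g -> fin_gen F ->
  (forall x y, polymod_map g (brF x y) = br (g x) (g y)) ->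
  lie_conformal brF.
Proof.
move=> g_inj genF gbr; have g1_inj := polymod_map_inj g_inj.
(* The coefficientwise extension of g to polynomials in lambda and mu. *)
pose g2 : polymod (polymod F) -> polymod (polymod E) :=
  polymod_map (polymod_map g : polymod F -> polymod E).
have g2_inj : injective g2 by exact: polymod_map_inj g1_inj.
have g2D : {morph g2 : p q / p + q} by move=> p q; rewrite /g2 linearD.
have CC0 : polymodC (polymodC (0 : E)) = 0 :> polymod (polymod E).
  by rewrite /polymodC !monalgU0.
have g2_br_at s x y : g2 (br_at brF s x y) = br_at br s (g x) (g y).
  rewrite /br_at /g2 linear_polymod_subst -gbr.
  rewrite polymod_subst_map; [|exact: CC0|exact: linear0].
  apply: eq_polymod_subst => m.
  by rewrite /= polymod_map_polymodC /= polymod_map_polymodC.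
have br_at0l s y : br_at br s 0 y = 0.
  by rewrite /br_at lie_br0l /polymod_subst msupp0 big_seq_fset0.
have br_at0r s x : br_at br s x 0 = 0.
  by rewrite /br_at lie_br0r /polymod_subst msupp0 big_seq_fset0.
have g2_substr s t x y z :
    g2 (polymod_subst (fun w => br_at brF s x w) t (brF y z))
    = polymod_subst (fun w => br_at br s (g x) w) t (br (g y) (g z)).
  rewrite /g2 linear_polymod_subst -gbr.
  rewrite polymod_subst_map; [|exact: br_at0r|exact: linear0].
  by apply: eq_polymod_subst => w; apply: g2_br_at.
have g2_substl s t x y z :
    g2 (polymod_subst (fun w => br_at brF s w z) t (brF x y))
    = polymod_subst (fun w => br_at br s w (g z)) t (br (g x) (g y)).
  rewrite /g2 linear_polymod_subst -gbr.
  rewrite polymod_subst_map; [|exact: br_at0l|exact: linear0].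
  by apply: eq_polymod_subst => w; apply: g2_br_at.
split=> //.
- move=> c x x' y; apply: g1_inj.
  by rewrite linearP /= !gbr linearP /= (lc_linear_l lie).
- move=> c x y y'; apply: g1_inj.
  by rewrite linearP /= !gbr linearP /= (lc_linear_r lie).
- move=> x y; apply: g1_inj.
  by rewrite linearN linearZ /= !gbr linearZ /= (lc_del_l lie).
- move=> x y; apply: g1_inj.
  by rewrite linearZ /= !gbr linearZ /= (lc_del_r lie).
- move=> x y; apply: g1_inj.
  by rewrite linearN /= polymod_map_at_opp !gbr (lc_skew lie).
- move=> x y z; apply: g2_inj.
  rewrite [LHS]g2_substr (lc_jacobi lie) g2D.
  by congr (_ + _); [apply/esym/g2_substl | apply/esym/g2_substr].
Qed.

End Bracket.

(** * The graph of a left deformation map *)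

Section Graph.
Context {E : lmodType Cdel} {br : E -> E -> polymod E} {Sa Sb : pred E}.
Context {a : subLmodType Sa} {b : subLmodType Sb}.
Variables (Q : quasi_twilled br a b) (B : {linear b -> a}).

Definition graph (u : b) : E := val (B u) + val u.

Fact graph_is_linear : linear graph.
Proof. by move=> c u v; rewrite /graph !linearP /= scalerDr addrACA. Qed.

HB.instance Definition _ :=
  GRing.isLinear.Build Cdel b E _ graph graph_is_linear.

Lemma graphK : cancel graph (qt_prb Q).
Proof.
move=> u; rewrite /graph linearD /= qt_prb_val_a add0r; apply: val_inj.
by rewrite [RHS](qt_decomp Q) qt_pra_val_b linear0 add0r.
Qed.

(** Skew-symmetry in [E] turns the third term of the deformed product into the
    component in [b] of [{u _lambda B v}]. *)
Lemma deformed_br_graph u v :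
  deformed_br Q B u v = polymod_map (qt_prb Q) (br (graph u) (graph v)).
Proof.
have lie := qt_lie_conformal Q.
rewrite /graph (lie_brDl lie) !(lie_brDr lie) !linearD /=.
rewrite /deformed_br /qt_br_b /qt_rho_a /qt_psi1 -polymod_map_at_opp.
rewrite (lc_skew lie (val u) (val (B v))) linearN /=.
rewrite addrC -[RHS]addrA; congr (_ + _).
by rewrite addrAC addrC [X in _ + X]addrC.
Qed.

(** [G \o P] fixes every element of the graph, and the coefficients of
    [{G u _lambda G v}] lie there because the graph is a subalgebra. *)
Lemma graph_br u v : left_deformation_map Q B ->
  polymod_map graph (deformed_br Q B u v) = br (graph u) (graph v).
Proof.
move=> graph_sub; rewrite deformed_br_graph; apply/malgP => k.
rewrite !coef_polymod_map ?linear0 //.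
have [||w ->] := lcs_br graph_sub (x := graph u) (y := graph v) k.
- by exists u.
- by exists v.
by rewrite -/(graph w) graphK.
Qed.

End Graph.
End LieConformal.

Theorem theorem4p8 (R : realType) (E : lmodType {poly R[i]})
    (br : E -> E -> polymod E) (Sa Sb : pred E)
    (a : subLmodType Sa) (b : subLmodType Sb)
    (Q : quasi_twilled br a b) (B : {linear b -> a}) :
  left_deformation_map Q B -> lie_conformal (deformed_br Q B).
Proof.
move=> graph_sub; have lie := qt_lie_conformal Q.
apply: (lie_conformal_inj lie (g := graph B)).
- exact: can_inj (graphK Q B).
- exact: fin_gen_surj (graphK Q B) (lc_fin_gen lie).
- by move=> u v; apply: graph_br.
Qed.
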